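(* Let $X$ be a real Banach space. Then $(Lip_0^{ph}(X),Lip(\cdot))$ is isometrically isomorphic to a dual space, i.e. there is a Banach space $Z$ such that $Lip_0^{ph}(X)$ is linearly isometrically isomorphic to $Z^*$.
   Context: $Lip_0(X)$ is the Banach space of all Lipschitz functions $f:X\to\mathbb{R}$ with $f(0)=0$, with norm $Lip(f)=\sup_{x\neq y}\frac{|f(x)-f(y)|}{\|x-y\|}$. $Lip_0^{ph}(X)=\{f\in Lip_0(X): f(\alpha x)=\alpha f(x)\ \forall \alpha\ge 0,\ x\in X\}$, with the same norm. *)

(* Defs.v *)
From HB Require Import structures.
From mathcomp Require Import all_boot all_order all_algebra.
From mathcomp Require Import all_classical all_reals topology normedtype.
Set Implicit Arguments.
Unset Strict Implicit.
Unset Printing Implicit Defensive.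
Import Order.TTheory GRing.Theory Num.Theory.
Import numFieldNormedType.Exports.
Local Open Scope classical_set_scope.
Local Open Scope ring_scope.

Lemma sup_nneg {R : realType} (S : set R) :
  (forall x, S x -> 0 <= x) -> 0 <= sup S.
Proof.
move=> S0; have [[[x Sx] ubS]|/sup_out->//] := pselect (has_sup S).
exact: le_trans (S0 x Sx) (ub_le_sup ubS Sx).
Qed.

(* Functions are valued in R^o rather than R, so that X -> R^o is canonically
   an R-module under the pointwise operations. *)

Section Lip.
Context {R : realType} {X : normedModType R}.
Implicit Types f g : X -> R^o.

(* The set is empty when X is trivial; then Lip f = sup set0 = 0. *)
Definition Lip f : R :=
  sup [set q : R | exists x y : X, x <> y /\ q = `|f x - f y| / `|x - y|].

Lemma lipschitzP f :
  lipschitz f <-> exists k : R, forall x y : X, `|f x - f y| <= k * `|x - y|.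
Proof.
split=> [/pinfty_ex_gt0[k _ kf]|[k kf]].
  by exists k => x y; exact: (kf (x, y)).
apply: (@klipschitzW _ _ _ k); last by move=> [x y] _; exact: kf.
exact: (@globally_properfilter _ _ (0, 0)).
Qed.

Lemma Lip_le f (k : R) : 0 <= k ->
  (forall x y : X, `|f x - f y| <= k * `|x - y|) -> Lip f <= k.
Proof.
move=> k0 kf; rewrite /Lip; set S := [set _ | _].
have [->|S0] := eqVneq S set0; first by rewrite sup0.
apply: ge_sup; first exact/set0P.
move=> _ [x [y [/eqP xy ->]]].
by rewrite ler_pdivrMr ?normr_gt0 ?subr_eq0.
Qed.

Lemma Lip_ge0 f : 0 <= Lip f.
Proof.
by apply: sup_nneg => _ [x [y [_ ->]]]; rewrite divr_ge0.
Qed.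

Lemma Lip_ge f : lipschitz f ->
  forall x y : X, `|f x - f y| <= Lip f * `|x - y|.
Proof.
move=> /lipschitzP[k kf] x y.
have [->|xy] := eqVneq x y; first by rewrite !subrr !normr0 mulr0.
have xy0 : 0 < `|x - y| by rewrite normr_gt0 subr_eq0.
rewrite -ler_pdivrMr//; apply: ub_le_sup; last by exists x, y; split=> //; exact/eqP.
exists k => _ [u [v [/eqP uv ->]]].
by rewrite ler_pdivrMr ?normr_gt0 ?subr_eq0.
Qed.

End Lip.

Section lip0.
Context {R : realType} (X : normedModType R).

Definition lip0_pred : {pred X -> R^o} :=
  [pred f : X -> R^o | `[< lipschitz f /\ f 0 = 0 >]].

Record lip0 := Lip0 { lip0_fun :> X -> R^o; lip0_in : lip0_fun \in lip0_pred }.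

HB.instance Definition _ := [isSub for lip0_fun].
HB.instance Definition _ := [Choice of lip0 by <:].

Lemma lip0_lipschitz (f : lip0) : lipschitz f.
Proof. by case: f => f /= /asboolP[]. Qed.

Lemma lip0_0 (f : lip0) : f 0 = 0.
Proof. by case: f => f /= /asboolP[]. Qed.

Fact lip0_submod_closed : subsemimod_closed lip0_pred.
Proof.
split; first split.
- apply/asboolP; split=> //; apply/lipschitzP; exists 0 => x y.
  by rewrite subrr normr0 mul0r.
- move=> f g /asboolP[/lipschitzP[k kf] f0] /asboolP[/lipschitzP[l lg] g0].
  apply/asboolP; split; last by rewrite !fctE f0 g0 addr0.
  apply/lipschitzP; exists (k + l) => x y; rewrite !fctE opprD addrACA mulrDl.
  exact: le_trans (ler_normD _ _) (lerD (kf x y) (lg x y)).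
- move=> a f /asboolP[/lipschitzP[k kf] f0].
  apply/asboolP; split; last by rewrite !fctE f0 scaler0.
  apply/lipschitzP; exists (`|a| * k) => x y.
  by rewrite !fctE -scalerBr normrZ -mulrA ler_wpM2l.
Qed.

HB.instance Definition _ :=
  GRing.SubChoice_isSubLmodule.Build R (X -> R^o) lip0_pred lip0
    lip0_submod_closed.

Lemma lip0_addE (f g : lip0) x : (f + g) x = f x + g x. Proof. by []. Qed.

Lemma lip0_scaleE (a : R) (f : lip0) x : (a *: f) x = a *: f x. Proof. by []. Qed.

Fact lip0_normD (f g : lip0) : Lip (f + g) <= Lip f + Lip g.
Proof.
apply: Lip_le; first by rewrite addr_ge0 ?Lip_ge0.
move=> x y; rewrite !lip0_addE opprD addrACA mulrDl.
apply: le_trans (ler_normD _ _) (lerD _ _); apply: Lip_ge; exact: lip0_lipschitz.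
Qed.

Fact lip0_normZ (a : R) (f : lip0) : Lip (a *: f) = `|a| * Lip f.
Proof.
have le (b : R) (g : lip0) : Lip (b *: g) <= `|b| * Lip g.
  apply: Lip_le; first by rewrite mulr_ge0 ?Lip_ge0.
  move=> x y; rewrite !lip0_scaleE -scalerBr normrZ -mulrA ler_wpM2l//.
  exact/Lip_ge/lip0_lipschitz.
apply/eqP; rewrite eq_le le/=.
have [->|a0] := eqVneq a 0; first by rewrite normr0 mul0r Lip_ge0.
rewrite -ler_pdivlMl ?normr_gt0// -normfV.
by have := le a^-1 (a *: f); rewrite scalerA mulVf// scale1r.
Qed.

Fact lip0_norm0 (f : lip0) : Lip f = 0 -> f = 0.
Proof.
move=> f0; apply/val_inj/funext => x /=.
have := Lip_ge (lip0_lipschitz f) x 0.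
by rewrite f0 mul0r lip0_0 subr0 normr_le0 => /eqP.
Qed.

HB.instance Definition _ :=
  Lmodule_isNormed.Build R lip0 lip0_normD lip0_normZ lip0_norm0.

Lemma lip0_normE (f : lip0) : `|f| = Lip f. Proof. by []. Qed.

End lip0.

Section lip0ph.
Context {R : realType} (X : normedModType R).

Definition lip0ph_pred : {pred lip0 X} :=
  [pred f : lip0 X | `[< forall (a : R) (x : X), 0 <= a -> f (a *: x) = a *: f x >]].

Record lip0ph := Lip0ph {
  lip0ph_lip0 :> lip0 X; lip0ph_in : lip0ph_lip0 \in lip0ph_pred }.

HB.instance Definition _ := [isSub for lip0ph_lip0].
HB.instance Definition _ := [Choice of lip0ph by <:].

Fact lip0ph_submod_closed : subsemimod_closed lip0ph_pred.
Proof.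
split; first split.
- by apply/asboolP => a x a0; rewrite scaler0.
- move=> f g /asboolP fP /asboolP gP; apply/asboolP => a x a0.
  by rewrite !lip0_addE fP// gP// scalerDr.
- move=> b f /asboolP fP; apply/asboolP => a x a0.
  by rewrite !lip0_scaleE fP// !scalerA mulrC.
Qed.

HB.instance Definition _ :=
  GRing.SubChoice_isSubLmodule.Build R (lip0 X) lip0ph_pred lip0ph
    lip0ph_submod_closed.

Lemma lip0ph_addE (f g : lip0ph) x : (f + g) x = f x + g x. Proof. by []. Qed.

Lemma lip0ph_scaleE (a : R) (f : lip0ph) x : (a *: f) x = a *: f x. Proof. by []. Qed.

Fact lip0ph_normD (f g : lip0ph) :
  `|lip0ph_lip0 (f + g)| <= `|lip0ph_lip0 f| + `|lip0ph_lip0 g|.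
Proof. exact: ler_normD. Qed.

Fact lip0ph_normZ (a : R) (f : lip0ph) :
  `|lip0ph_lip0 (a *: f)| = `|a| * `|lip0ph_lip0 f|.
Proof. exact: normrZ. Qed.

Fact lip0ph_norm0 (f : lip0ph) : `|lip0ph_lip0 f| = 0 -> f = 0.
Proof. by move=> /normr0_eq0 f0; exact: val_inj. Qed.

HB.instance Definition _ :=
  Lmodule_isNormed.Build R lip0ph lip0ph_normD lip0ph_normZ lip0ph_norm0.

Lemma lip0ph_normE (f : lip0ph) : `|f| = Lip f. Proof. by []. Qed.

End lip0ph.

Section dual_space.
Context {R : realType} (Z : normedModType R).
Implicit Types f : Z -> R^o.

Definition opnorm f : R := sup [set `|f z| | z in [set z : Z | `|z| <= 1]].

Definition dual_pred : {pred Z -> R^o} :=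
  [pred f : Z -> R^o | `[< linear f /\ continuous f >]].

Record dual_space := Dual { dual_fun :> Z -> R^o; dual_in : dual_fun \in dual_pred }.

HB.instance Definition _ := [isSub for dual_fun].
HB.instance Definition _ := [Choice of dual_space by <:].

Lemma dual_linear (f : dual_space) : linear f.
Proof. by case: f => f /= /asboolP[]. Qed.

Lemma dual_continuous (f : dual_space) : continuous f.
Proof. by case: f => f /= /asboolP[]. Qed.

HB.instance Definition _ (f : dual_space) :=
  GRing.isLinear.Build R Z R^o _ f (dual_linear f).

Fact dual_submod_closed : subsemimod_closed dual_pred.
Proof.
split; first split.
- apply/asboolP; split; last exact: cst_continuous.
  by move=> a x y; rewrite scaler0 addr0.
- move=> f g /asboolP[fl fc] /asboolP[gl gc]; apply/asboolP; split.
    by move=> a x y; rewrite !fctE fl gl scalerDr addrACA.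
  by move=> x; apply: cvgD; [exact: fc|exact: gc].
- move=> b f /asboolP[fl fc]; apply/asboolP; split.
    by move=> a x y; rewrite !fctE fl scalerDr !scalerA mulrC.
  by move=> x; apply: cvgZr; exact: fc.
Qed.

HB.instance Definition _ :=
  GRing.SubChoice_isSubLmodule.Build R (Z -> R^o) dual_pred dual_space
    dual_submod_closed.

Lemma dual_addE (f g : dual_space) x : (f + g) x = f x + g x. Proof. by []. Qed.

Lemma dual_scaleE (a : R) (f : dual_space) x : (a *: f) x = a *: f x. Proof. by []. Qed.

Lemma opnorm_le f (k : R) :
  (forall z, `|z| <= 1 -> `|f z| <= k) -> opnorm f <= k.
Proof.
move=> kf; apply: ge_sup; first by exists `|f 0|, 0 => //=; rewrite normr0.
by move=> _ [z z1 <-]; exact: kf.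
Qed.

Lemma opnorm_ge0 f : 0 <= opnorm f.
Proof. by apply: sup_nneg => _ [z _ <-]. Qed.

Lemma opnorm_ge (f : dual_space) (z : Z) : `|f z| <= opnorm f * `|z|.
Proof.
have [M fM] : exists M : R, forall x, `|x| <= 1 -> `|f x| <= M.
  apply: (proj2 (bounded_funP f)).
  exact/linear_bounded_continuous/dual_continuous.
have [->|z0] := eqVneq z 0; first by rewrite linear0 !normr0 mulr0.
have nz0 : 0 < `|z| by rewrite normr_gt0.
rewrite -ler_pdivrMr// mulrC.
have -> : `|z|^-1 * `|f z| = `|f (`|z|^-1 *: z)|.
  by rewrite linearZ normrZ ger0_norm ?invr_ge0.
apply: ub_le_sup; first by exists M => _ [x x1 <-]; exact: fM.
by exists (`|z|^-1 *: z) => //=; rewrite normrZ ger0_norm ?invr_ge0// mulVf ?gt_eqF.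
Qed.

Let opnorm_ge1 (f : dual_space) (z : Z) : `|z| <= 1 -> `|f z| <= opnorm f.
Proof.
move=> z1; apply: le_trans (opnorm_ge f z) _.
by rewrite -[leRHS]mulr1 ler_wpM2l// opnorm_ge0.
Qed.

Fact dual_normD (f g : dual_space) : opnorm (f + g) <= opnorm f + opnorm g.
Proof.
apply: opnorm_le => z z1; rewrite dual_addE.
by apply: le_trans (ler_normD _ _) (lerD _ _); exact: opnorm_ge1.
Qed.

Fact dual_normZ (a : R) (f : dual_space) : opnorm (a *: f) = `|a| * opnorm f.
Proof.
have le (b : R) (g : dual_space) : opnorm (b *: g) <= `|b| * opnorm g.
  by apply: opnorm_le => z z1; rewrite dual_scaleE normrZ ler_wpM2l// opnorm_ge1.
apply/eqP; rewrite eq_le le/=.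
have [->|a0] := eqVneq a 0; first by rewrite normr0 mul0r opnorm_ge0.
rewrite -ler_pdivlMl ?normr_gt0// -normfV.
by have := le a^-1 (a *: f); rewrite scalerA mulVf// scale1r.
Qed.

Fact dual_norm0 (f : dual_space) : opnorm f = 0 -> f = 0.
Proof.
move=> f0; apply/val_inj/funext => z /=.
by have := opnorm_ge f z; rewrite f0 mul0r normr_le0 => /eqP.
Qed.

HB.instance Definition _ :=
  Lmodule_isNormed.Build R dual_space dual_normD dual_normZ dual_norm0.

Lemma dual_normE (f : dual_space) : `|f| = opnorm f. Proof. by []. Qed.

End dual_space.

Definition isometrically_isomorphic {R : realType} (V W : normedModType R) :=
  exists T : {linear V -> W}, bijective T /\ forall v, `|T v| = `|v|.

(* Main.v *)
(** The predual is the closed linear span, inside the dual of [lip0ph X], of the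
    evaluations [f |-> f x].  Each [f] pairs isometrically with it because
    [x |-> evaluation x] is nonexpansive.  Conversely, restricting a functional
    [psi] on the span to the evaluations gives a function [x |-> psi (evaluation x)]
    which is Lipschitz with constant [`|psi|] and is positively homogeneous since
    [evaluation (a *: x) = a *: evaluation x] for [a >= 0]; it represents [psi] on
    the evaluations, hence, by continuity, on their closed span. *)

Require Import Defs.
From HB Require Import structures.
From mathcomp Require Import all_boot all_order all_algebra.
From mathcomp Require Import all_classical all_reals topology normedtype.
Set Implicit Arguments.
Unset Strict Implicit.
Unset Printing Implicit Defensive.
Import Order.TTheory GRing.Theory Num.Theory.
Import numFieldNormedType.Exports.
Local Open Scope classical_set_scope.
Local Open Scope ring_scope.

(** * Completeness of the dual of a normed space *)

Section dual_complete.
Context {R : realType} (W : normedModType R).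

Lemma dual_pred_bounded (f : W -> R^o) (M : R) : linear f ->
  (forall w, `|f w| <= M * `|w|) -> f \in @dual_pred R W.
Proof.
move=> lf fM; apply/asboolP; split => //.
pose g : {linear W -> R^o} := HB.pack f (GRing.isLinear.Build R W R^o _ f lf).
apply: (@bounded_linear_continuous _ _ _ g); apply/linear_boundedP.
near=> r => w; apply: (le_trans (fM w)); rewrite ler_wpM2r//.
by near: r; apply: nbhs_pinfty_ge; rewrite num_real.
Unshelve. all: by end_near. Qed.

Lemma dual_norm_le (f : dual_space W) (k : R) : 0 <= k ->
  (forall w, `|f w| <= k * `|w|) -> `|f| <= k.
Proof.
move=> k0 fk; rewrite dual_normE; apply: opnorm_le => w w1.
by apply: le_trans (fk w) _; rewrite ler_piMr.
Qed.

Lemma dual_subE (f g : dual_space W) w : (f - g) w = f w - g w.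
Proof. by []. Qed.

(** Pointwise limits along [F] exist because evaluation at [w] is Lipschitz with constant [|w|]. The
    Cauchy estimate survives in the limit uniformly in [w], which makes the pointwise limit both
    bounded and a limit in norm. *)
Lemma dual_complete (F : set_system (dual_space W)) :
  ProperFilter F -> cauchy F -> cvg F.
Proof.
move=> FF Fc.
have Fce e : 0 < e -> \forall f \near F, \forall g \near F, `|f - g| <= e.
  move=> e0; apply: (@nearP_dep _ _ F F).
  apply: filterS ((cauchy_ballP F).2 Fc e e0) => -[f g].
  by rewrite -ball_normE /= => /ltW.
have Fw w : cvg ((fun f : dual_space W => f w : R^o) @ F).
  apply: cauchy_cvg; apply: cauchy_exP => e e0.
  (* The added 1 covers [w = 0] and makes the final bound [e * |w| / (|w| + 1) < e] strict, as an
     open ball requires. *)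
  have d0 : 0 < e / (`|w| + 1) by rewrite divr_gt0// ltr_wpDl.
  have [f Ff] := filter_ex (Fce _ d0).
  exists (f w); rewrite /nbhs /= in Ff *.
  apply: filterS Ff => g /= fg; rewrite -ball_normE /= -dual_subE.
  apply: le_lt_trans (opnorm_ge _ _) _; rewrite -dual_normE.
  apply: le_lt_trans (ler_wpM2r (normr_ge0 _) fg) _.
  by rewrite mulrAC ltr_pdivrMr ?ltr_wpDl// ltr_pM2l// ltrDl.
pose l : W -> R^o := fun w => lim ((fun f : dual_space W => f w : R^o) @ F).
have ll : linear l.
  move=> a x y; apply: cvg_lim => //.
  apply: (@cvg_trans _ ((fun f : dual_space W => a *: f x + f y : R^o) @ F)).
    by apply: near_eq_cvg; near=> f; rewrite linearP.
  by apply: cvgD; [apply: cvgZr; exact: Fw|exact: Fw].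
(* Fix [f] and let [g] run along [F] in [|g w - f w| <= e * |w|]; the choice of [f] does not depend
   on [w]. *)
have lF e : 0 < e -> \forall f \near F, forall w, `|l w - (f : dual_space W) w| <= e * `|w|.
  move=> /Fce; apply: filterS => f Ff w.
  have cw : (fun g : dual_space W => `|g w - f w|) @ F --> `|l w - f w|.
    by apply: cvg_norm; apply: cvgB; [exact: Fw|exact: cvg_cst].
  rewrite -(cvg_lim _ cw)//; apply: limr_le; first by apply/cvg_ex; exists `|l w - f w|.
  apply: filterS Ff => g fg; rewrite distrC -dual_subE.
  by apply: le_trans (opnorm_ge _ _) _; rewrite -dual_normE ler_wpM2r.
(* A single [f0] at distance at most 1 from [l] bounds [l] by [1 + |f0|]. *)
have [f0 lf0] := filter_ex (lF _ ltr01).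
have lP : l \in @dual_pred R W.
  apply: (dual_pred_bounded (M := 1 + `|f0|)) => // w.
  rewrite -(subrK (f0 w) (l w)) mulrDl; apply: le_trans (ler_normD _ _) _.
  by apply: lerD (lf0 w) (opnorm_ge _ _).
apply/cvg_ex; exists (Dual lP); apply/cvgrPdist_le => e e0.
apply: filterS (lF _ e0) => f lf; apply: dual_norm_le => [|w]; first exact: ltW.
by rewrite dual_subE; exact: lf.
Unshelve. all: by end_near. Qed.

HB.instance Definition _ := Uniform_isComplete.Build (dual_space W) dual_complete.

End dual_complete.

(** * Closed linear spans in a Banach space *)

Section closed_span.
Context {R : realType} (V : completeNormedModType R) (D : set V).

(** Adding one scaled generator at a time gives all finite linear combinations, with induction on
    their length built in. *)
Inductive lin_span : set V :=
| lin_span0 : lin_span 0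
| lin_spanZD a d v : D d -> lin_span v -> lin_span (a *: d + v).

Lemma lin_spanD u v : lin_span u -> lin_span v -> lin_span (u + v).
Proof.
move=> + sv; elim=> [|a d u' Dd _ su']; first by rewrite add0r.
by rewrite -addrA; exact: lin_spanZD.
Qed.

Lemma lin_spanZ a v : lin_span v -> lin_span (a *: v).
Proof.
elim=> [|b d u Dd _ su]; first by rewrite scaler0; exact: lin_span0.
by rewrite scalerDr scalerA; exact: lin_spanZD.
Qed.

Definition closed_span_pred : {pred V} :=
  [pred v : V | `[< forall e : R, 0 < e ->
    exists2 u, lin_span u & `|v - u| <= e >]].

Record closed_span := ClosedSpan {
  closed_span_val :> V; closed_span_in : closed_span_val \in closed_span_pred }.

HB.instance Definition _ := [isSub for closed_span_val].
HB.instance Definition _ := [Choice of closed_span by <:].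

Fact closed_span_submod_closed : subsemimod_closed closed_span_pred.
Proof.
split; first split.
- apply/asboolP => e e0; exists 0; first exact: lin_span0.
  by rewrite subrr normr0 ltW.
- move=> u v /asboolP uP /asboolP vP; apply/asboolP => e e0.
  have e20 : 0 < e / 2 by rewrite divr_gt0.
  have [u' su' uu'] := uP _ e20; have [v' sv' vv'] := vP _ e20.
  exists (u' + v'); first exact: lin_spanD.
  rewrite opprD addrACA (splitr e).
  exact: le_trans (ler_normD _ _) (lerD uu' vv').
- move=> a v /asboolP vP; apply/asboolP => e e0.
  have d0 : 0 < e / (`|a| + 1) by rewrite divr_gt0// ltr_wpDl.
  have [v' sv' vv'] := vP _ d0.
  exists (a *: v'); first exact: lin_spanZ.
  rewrite -scalerBr normrZ; apply: le_trans (ler_wpM2l (normr_ge0 _) vv') _.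
  by rewrite mulrA ler_pdivrMr ?ltr_wpDl// mulrC ler_pM2l// lerDl.
Qed.

HB.instance Definition _ :=
  GRing.SubChoice_isSubLmodule.Build R V closed_span_pred closed_span
    closed_span_submod_closed.

Fact closed_span_normD (u v : closed_span) :
  `|closed_span_val (u + v)| <= `|closed_span_val u| + `|closed_span_val v|.
Proof. exact: ler_normD. Qed.

Fact closed_span_normZ (a : R) (u : closed_span) :
  `|closed_span_val (a *: u)| = `|a| * `|closed_span_val u|.
Proof. exact: normrZ. Qed.

Fact closed_span_norm0 (u : closed_span) : `|closed_span_val u| = 0 -> u = 0.
Proof. by move=> /normr0_eq0 u0; exact: val_inj. Qed.

HB.instance Definition _ :=
  Lmodule_isNormed.Build R closed_span
    closed_span_normD closed_span_normZ closed_span_norm0.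

(** The limit exists in [V]; it is within [e / 2] of a point of the closed span, itself within
    [e / 2] of the linear span, so it stays in the closed span. *)
Lemma closed_span_complete (F : set_system closed_span) :
  ProperFilter F -> cauchy F -> cvg F.
Proof.
move=> FF Fc.
have Gc : cvg (closed_span_val u @[u --> F]).
  apply: cauchy_cvg; apply: cauchy_exP => e e0.
  have [u Fu] := (cauchyP F).1 Fc e e0.
  exists (closed_span_val u); rewrite /nbhs /=.
  by apply: filterS Fu => v; rewrite -!ball_normE.
move/cvg_ex : Gc => [/= v Fv].
have vP : v \in closed_span_pred.
  apply/asboolP => e e0; have e20 : 0 < e / 2 by rewrite divr_gt0.
  have [u uv] := filter_ex ((cvgrPdist_le _ _).1 Fv _ e20).
  have /asboolP/(_ _ e20)[w sw uw] := closed_span_in u.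
  exists w => //; rewrite -(subrK (closed_span_val u) v) -addrA (splitr e).
  exact: le_trans (ler_normD _ _) (lerD uv uw).
(* The span carries the norm of [V], so convergence in [V] is already the convergence sought. *)
apply/cvg_ex; exists (ClosedSpan vP); apply/cvgrPdist_le => e e0.
exact: ((cvgrPdist_le _ _).1 Fv _ e0).
Qed.

HB.instance Definition _ := Uniform_isComplete.Build closed_span closed_span_complete.

Lemma lin_span_closed_span v : lin_span v -> v \in closed_span_pred.
Proof.
by move=> sv; apply/asboolP => e e0; exists v => //; rewrite subrr normr0 ltW.
Qed.

Lemma closed_span_gen v : D v -> v \in closed_span_pred.
Proof.
move=> Dv; apply: lin_span_closed_span; rewrite -[v]scale1r -[_ *: _]addr0.
exact: lin_spanZD Dv lin_span0.
Qed.

(** By induction [f - g] vanishes on the linear span; being bounded, it vanishes on the closure. *)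
Lemma eq_dual_closed_span (f g : dual_space closed_span) :
  (forall v (Dv : D v), f (ClosedSpan (closed_span_gen Dv)) =
                        g (ClosedSpan (closed_span_gen Dv))) -> f = g.
Proof.
move=> fg.
(* The membership proof is quantified after [lin_span v] because the induction changes the vector it
   is about. *)
have fgs v : lin_span v -> forall vP : v \in closed_span_pred,
    (f - g) (ClosedSpan vP) = 0.
  elim=> [|a d u Dd su IH] vP.
    by rewrite -[RHS](linear0 (f - g)); congr (_ _); exact: val_inj.
  have -> : ClosedSpan vP = a *: ClosedSpan (closed_span_gen Dd) +
      ClosedSpan (lin_span_closed_span su) by exact: val_inj.
  by rewrite dual_linear IH addr0 dual_subE fg subrr scaler0.
apply/eqP; rewrite -subr_eq0; apply/eqP/val_inj/funext => v.
apply/eqP; rewrite -[eqbLHS]/((f - g) v) -normr_le0; apply/ler_addgt0Pl => e e0; rewrite addr0.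
have d0 : 0 < e / (`|f - g| + 1) by rewrite divr_gt0// ltr_wpDl.
have /asboolP/(_ _ d0)[u su vu] := closed_span_in v.
pose u' := ClosedSpan (lin_span_closed_span su).
have -> : (f - g) v = (f - g) (v - u').
  have -> : (f - g) (v - u') = (f - g) v - (f - g) u' by exact: linearB.
  by rewrite fgs// subr0.
apply: le_trans (opnorm_ge _ _) _; rewrite -dual_normE.
apply: le_trans (ler_wpM2l (normr_ge0 _) vu) _.
by rewrite mulrA ler_pdivrMr ?ltr_wpDl// mulrC ler_pM2l// lerDl.
Qed.

End closed_span.

(** * Evaluation functionals, the predual and its pairing *)

Section predual.
Context {R : realType} (X : normedModType R).

Lemma evaluation_dual (x : X) : (fun f : lip0ph X => f x : R^o) \in @dual_pred R (lip0ph X).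
Proof.
apply: (dual_pred_bounded (M := `|x|)) => // f.
have := Lip_ge (lip0_lipschitz f) x 0.
by rewrite lip0_0 !subr0 lip0ph_normE mulrC.
Qed.

Definition evaluation (x : X) : dual_space (lip0ph X) := Dual (evaluation_dual x).

Lemma evaluation0 : evaluation 0 = 0.
Proof. by apply/val_inj/funext => f; exact: lip0_0. Qed.

Lemma evaluationZ (a : R) x : 0 <= a -> evaluation (a *: x) = a *: evaluation x.
Proof.
move=> a0; apply/val_inj/funext => f /=.
by case: f => f fP /=; move/asboolP : (fP) => ->.
Qed.

Lemma evaluation_nonexpansive x y : `|evaluation x - evaluation y| <= `|x - y|.
Proof.
by apply: dual_norm_le => // f; rewrite mulrC; exact: Lip_ge (lip0_lipschitz f) x y.
Qed.

Definition predual := closed_span (range evaluation).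

Definition predual_evaluation (x : X) : predual :=
  ClosedSpan (closed_span_gen (imageT evaluation x)).

Lemma pairing_dual (f : lip0ph X) :
  (fun z : predual => closed_span_val z f : R^o) \in @dual_pred R predual.
Proof.
apply: (dual_pred_bounded (M := `|f|)) => // z.
by rewrite mulrC; exact: opnorm_ge.
Qed.

Definition pairing (f : lip0ph X) : dual_space predual := Dual (pairing_dual f).

Lemma pairing_linear : linear pairing.
Proof.
by move=> a f g; apply/val_inj/funext => z /=; exact: (dual_linear (closed_span_val z)).
Qed.

HB.instance Definition _ :=
  GRing.isLinear.Build R (lip0ph X) (dual_space predual) _ pairing pairing_linear.

Lemma pairing_isometry f : `|pairing f| = `|f|.
Proof.
apply/eqP; rewrite eq_le; apply/andP; split.
  by apply: dual_norm_le => // z; rewrite mulrC; exact: (opnorm_ge (closed_span_val z)).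
(* Testing [pairing f] on a difference of evaluations yields [f x - f y], so [|pairing f|] is a
   Lipschitz constant of [f]. *)
rewrite lip0ph_normE; apply: Lip_le => // x y.
have := opnorm_ge (pairing f) (predual_evaluation x - predual_evaluation y).
move/le_trans; apply; rewrite -dual_normE ler_wpM2l//.
exact: evaluation_nonexpansive.
Qed.

Lemma pairing_inj : injective pairing.
Proof.
move=> f g /eqP; rewrite -subr_eq0 -linearB -normr_eq0 pairing_isometry.
by rewrite normr_eq0 subr_eq0 => /eqP.
Qed.

Lemma pairing_surj (psi : dual_space predual) : exists f, pairing f = psi.
Proof.
pose f x : R^o := psi (predual_evaluation x).
have fP : f \in @lip0_pred R X.
  apply/asboolP; split; last first.
    by rewrite /f -[RHS](linear0 psi); congr (psi _); apply: val_inj; exact: evaluation0.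
  apply/lipschitzP; exists `|psi| => x y; rewrite /f -linearB.
  apply: le_trans (opnorm_ge _ _) _; rewrite -dual_normE ler_wpM2l//.
  exact: evaluation_nonexpansive.
have fph : Lip0 fP \in @lip0ph_pred R X.
  apply/asboolP => a x a0 /=; rewrite /f -linearZ; congr (psi _).
  by apply: val_inj; exact: evaluationZ.
exists (Lip0ph fph); apply: eq_dual_closed_span => v Dv; have [x _ xv] := Dv.
(* The generator [v] is [evaluation x], but its membership proof may differ from the one in
   [predual_evaluation x]; [val_inj] identifies the two points. *)
transitivity (f x); first by rewrite /= -xv.
by congr (psi _); exact: val_inj.
Qed.

End predual.

Theorem mainTheorem3 (R : realType) (X : completeNormedModType R) :
  exists Z : completeNormedModType R,
    isometrically_isomorphic (lip0ph X) (dual_space Z).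
Proof.
exists (predual X : completeNormedModType R); exists (@pairing R X).
split; last exact: pairing_isometry.
(* Choice turns surjectivity into a right inverse; injectivity makes it a left inverse too. *)
have [g gP] := choice (@pairing_surj R X).
by exists g => // f; apply: pairing_inj; rewrite gP.
Qed.
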